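(* Let $N>M>2$, $0<\alpha<1$, let $\vec w=(w_1,\dots,w_N)$ be a weight vector with positive entries summing to $1$, let $$C_i(\alpha)=\left|\left\{\mathcal{M}\subseteq[N]:\ |\mathcal{M}|=M,\ i\in\mathcal{M},\ \sum_{m\in\mathcal{M}}w_m\ge\alpha\right\}\right|,$$ suppose $C_i(\alpha)>0$ for every $i\in[N]$, and let $$p_i=\frac{w_i/C_i(\alpha)}{\sum_{j=1}^N w_j/C_j(\alpha)},\qquad i\in[N].$$ Then the sortition algorithm Weighted Rejection Sampling with these $p_i$ is $\lambda$-decentralized for some $$\lambda\ \ge\ \min_{i\in[N]} w_i\left(1+\frac{F_i}{p_i}\right),$$ where $F_i$ is the sum of the $M-1$ smallest of the numbers $p_j$, $j\in[N]\setminus\{i\}$.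
   Context: Setting: there are $N$ participants, indexed by $[N]=\{1,\dots,N\}$, with positive weights $w_i$, $\sum_i w_i=1$. A sortition algorithm outputs a random committee $\mathcal{M}\subseteq[N]$ of size $M$ and unnormalized weights $g_n$; the voting power is $g(n;\mathcal{M})=g_n/\sum_{m\in\mathcal{M}}g_m$ for $n\in\mathcal{M}$ and $g(n;\mathcal{M})=0$ for $n\notin\mathcal{M}$. For $\lambda>0$, the algorithm is $\lambda$-decentralized if for every committee realization $\mathcal{M}$ (every committee that can be output), $\max_{m\in\mathcal{M}}\frac{g(m;\mathcal{M})}{w_m}\le\frac1\lambda$. Algorithm Weighted Rejection Sampling (input $\vec w$, $M$, $\alpha$): (1) compute the numbers $p_i$; (2) generate a uniformly random $M$-element subset $\mathcal{M}=\{m_1,\dots,m_M\}$ of $[N]$; (3) generate an independent $U$ uniform on $[0,1]$; if $U\ge\left(\sum_{j=1}^M p_{m_j}\right)\cdot\mathbf{1}\left(\sum_{j=1}^M w_{m_j}\ge\alpha\right)$, reject $\mathcal{M}$ and return to step (2) with fresh independent randomness; (4) otherwise output $\mathcal{M}$ with $g_m=p_m$ for $m\in\mathcal{M}$ and $g_m=0$ for $m\notin\mathcal{M}$. *)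

(* Defs.v *)
From HB Require Import structures.
From mathcomp Require Import all_boot all_order all_algebra.
From mathcomp Require Import all_classical all_reals all_analysis.

Set Implicit Arguments.
Unset Strict Implicit.
Unset Printing Implicit Defensive.

Import Order.TTheory GRing.Theory Num.Theory.
Import numFieldNormedType.Exports.

Local Open Scope classical_set_scope.
Local Open Scope ring_scope.

(* Participants are 'I_N = {0, ..., N-1}. A sortition algorithm is a random
   committee S : T -> option {set 'I_N} on a probability space, where None
   stands for "no output" (the algorithm never halts), together with
   unnormalized weights g : {set 'I_N} -> 'I_N -> R attached to each committee. *)

Definition voting_power (R : realType) (N : nat)
    (g : {set 'I_N} -> 'I_N -> R) (n : 'I_N) (A : {set 'I_N}) : R :=
  if n \in A then g A n / \sum_(m in A) g A m else 0.

(* The committees that can be output are those of positive probability. The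
   notion is meant for lambda > 0, so the default value 0 of the maximum does
   not affect the bound. *)
Definition decentralized (R : realType) (d : measure_display)
    (T : measurableType d) (P : probability T R) (N : nat) (w : 'I_N -> R)
    (S : T -> option {set 'I_N}) (g : {set 'I_N} -> 'I_N -> R)
    (lambda : R) : Prop :=
  forall A : {set 'I_N}, (0 < P [set t | S t = Some A])%E ->
    \big[Num.max/0]_(m in A) (voting_power g m A / w m) <= lambda^-1.

Section WeightedRejectionSampling.
Context {R : realType} {N : nat}.
Implicit Types (w p : 'I_N -> R) (M : nat) (alpha : R).

Definition committee_count w M alpha (i : 'I_N) : nat :=
  #|[set A : {set 'I_N} |
      [&& #|A| == M, i \in A & alpha <= \sum_(m in A) w m]]%SET|.

Definition wrs_p w M alpha (i : 'I_N) : R :=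
  (w i / (committee_count w M alpha i)%:R) /
  \sum_(j < N) (w j / (committee_count w M alpha j)%:R).

Definition wrs_accept w p alpha (A : {set 'I_N}) (u : R) : bool :=
  u < (\sum_(m in A) p m) * (alpha <= \sum_(m in A) w m)%R%:R.

(* In round k the proposal is X k and the uniform variable is U k; the output
   is the proposal of the first accepted round. *)
Definition wrs_committee (T : Type) w p alpha
    (X : nat -> T -> {set 'I_N}) (U : nat -> T -> R) (t : T) :
    option {set 'I_N} :=
  match pselect (exists k, wrs_accept w p alpha (X k t) (U k t)) with
  | left accepted => Some (X (ex_minn accepted) t)
  | right _ => None
  end.

Definition wrs_weight p (A : {set 'I_N}) (m : 'I_N) : R :=
  if m \in A then p m else 0.

(* In wrs_indep, taking A k or B k to be the full set drops the corresponding
   variable, so the product rule over the first n rounds is the product rule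
   over every finite subfamily of (X k)_k, (U k)_k. *)
Record wrs_randomness (d : measure_display) (T : measurableType d)
    (P : probability T R) (M : nat) (X : nat -> T -> {set 'I_N})
    (U : nat -> {RV P >-> R}) : Prop := WrsRandomness {
  wrs_measurable : forall k (A : {set 'I_N}), measurable (X k @^-1` [set A]);
  wrs_proposal : forall k (A : {set 'I_N}),
    P (X k @^-1` [set A]) =
      (if #|A| == M then ('C(N, M)%:R)^-1 else 0)%:E;
  wrs_uniform : forall k (B : set R), measurable B ->
    distribution P (U k) B = uniform_prob (@ltr01 R) B;
  wrs_indep : forall n (A : nat -> set {set 'I_N}) (B : nat -> set R),
    (forall k, measurable (B k)) ->
    P (\bigcap_(k in `I_n) (X k @^-1` A k `&` U k @^-1` B k)) =
      (\prod_(k < n) (P (X k @^-1` A k) * P (U k @^-1` B k)))%E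
}.

Definition smallest_sum p M (i : 'I_N) : R :=
  \sum_(x <- take M.-1 (sort <=%R [seq p j | j <- enum 'I_N & j != i])) x.

End WeightedRejectionSampling.

(* Main.v *)
(** The minimum itself serves as lambda. A committee A output with positive
    probability has exactly M members, and for m in A the ratio of voting power
    to weight is 1 / (w_m (1 + sum_(j in A, j != m) p_j / p_m)). The inner sum
    has M - 1 terms with indices different from m, so it is at least F_m, and
    the ratio is at most 1 / lambda. *)

Require Import Defs.
From HB Require Import structures.
From mathcomp Require Import all_boot all_order all_algebra.
From mathcomp Require Import all_classical all_reals all_analysis.

Set Implicit Arguments.
Unset Strict Implicit.
Unset Printing Implicit Defensive.

Import Order.TTheory GRing.Theory Num.Theory.
Import numFieldNormedType.Exports.

Local Open Scope classical_set_scope.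
Local Open Scope ring_scope.

Section SmallestSums.
Context {R : realType}.

(** The k-th entry of [t] occurs in [s] at position k or later, so it is at least the k-th entry of
    [s]; the induction compares the sums head by head. *)
Lemma sum_take_sorted_le_subseq (s t : seq R) : sorted <=%R s -> subseq t s ->
  \sum_(x <- take (size t) s) x <= \sum_(x <- t) x.
Proof.
elim: s t => [|x s IHs] [|y t] //= xs ts; rewrite ?take0 ?big_nil ?lexx//.
rewrite !big_cons lerD//.
  (* If the heads differ, the head of [t] lies in the tail of the sorted list, hence is at least
     [x]. *)
  move: ts; case: eqVneq => [-> //|_ ts].
  by move: xs; rewrite path_sortedE; last exact: le_trans;
    move=> /andP[/allP + _]; apply; rewrite (mem_subseq ts)// mem_head.
apply: IHs; first exact: path_sorted xs.
move: ts; case: eqVneq => // _; apply: subseq_trans; exact: subseq_cons.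
Qed.

Lemma smallest_sum_le (N M : nat) (p : 'I_N -> R) (A : {set 'I_N}) (i : 'I_N) :
  #|A| = M -> i \in A -> smallest_sum p M i <= \sum_(j in A | j != i) p j.
Proof.
move=> cardA iA; rewrite /smallest_sum.
set s := [seq p j | j <- _ & _].
set t := [seq p j | j <- enum 'I_N & (j \in A) && (j != i)].
have -> : \sum_(j in A | j != i) p j = \sum_(x <- sort <=%R t) x.
  rewrite (perm_big t); last exact/permPl/perm_sort.
  by rewrite big_map big_filter big_enum_cond.
(* Removing [i] from [A] leaves [M.-1] members, so the truncation has exactly the length of [t]. *)
have -> : M.-1 = size (sort <=%R t).
  rewrite size_sort size_map -cardA (cardD1 i) iA /=.
  rewrite -sum1_size big_filter big_enum_cond sum1_card.
  by apply: eq_card => j; rewrite !inE andbC.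
(* Sorting preserves the subsequence relation, so it is enough to compare the unsorted lists: [t]
   filters [s] further by membership in [A]. *)
apply: sum_take_sorted_le_subseq; first exact: (sort_sorted le_total).
apply: subseq_sort; [exact: le_total|exact: le_trans|].
apply: map_subseq.
by rewrite filter_predI filter_subseq.
Qed.

Lemma smallest_sum_ge0 (N M : nat) (p : 'I_N -> R) (i : 'I_N) :
  (forall j, 0 <= p j) -> 0 <= smallest_sum p M i.
Proof.
move=> p_ge0; rewrite /smallest_sum big_seq sumr_ge0// => x /mem_take.
by rewrite mem_sort => /mapP[j _ ->].
Qed.

End SmallestSums.

Section Committees.
Context {R : realType} {N : nat}.
Implicit Types (w p : 'I_N -> R) (M : nat) (alpha : R).

Lemma wrs_p_gt0 w M alpha : (forall i, 0 < w i) ->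
  (forall i, (0 < committee_count w M alpha i)%N) ->
  forall i, 0 < wrs_p w M alpha i.
Proof.
move=> w_gt0 C_gt0 i; have q_gt0 j : 0 < w j / (committee_count w M alpha j)%:R.
  by rewrite divr_gt0 ?ltr0n.
by rewrite divr_gt0// (bigD1 i)//= ltr_pwDl// sumr_ge0// => j _; exact: ltW.
Qed.

Lemma wrs_voting_power_le w p M lambda : 0 < lambda ->
  (forall i, 0 < w i) -> (forall i, 0 < p i) ->
  (forall i, lambda <= w i * (1 + smallest_sum p M i / p i)) ->
  forall (A : {set 'I_N}) (i : 'I_N), #|A| = M -> i \in A ->
  voting_power (wrs_weight p) i A / w i <= lambda^-1.
Proof.
move=> lambda_gt0 w_gt0 p_gt0 lambda_le A i cardA iA.
rewrite /voting_power iA /wrs_weight iA -big_mkcondr/=.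
under eq_bigl do rewrite andbb.
have sum_gt0 : 0 < \sum_(j in A) p j.
  by rewrite (bigD1 i)//= ltr_pwDl// sumr_ge0// => j _; exact: ltW.
rewrite -mulrA -invfM ler_pdivrMr ?mulr_gt0// mulrC ler_pdivlMr//.
(* Multiplying the bound on [lambda] by [p i] clears the inner fraction and leaves
   [w i * (p i + smallest_sum p M i)], to be compared with [w i] times the sum of [p] over [A]. *)
have := lambda_le i; rewrite -(ler_pM2l (p_gt0 i)) => /le_trans; apply.
rewrite mulrCA mulrDr mulr1 mulrCA divff ?gt_eqF// mulr1 mulrC.
by rewrite ler_pM2r// (bigD1 i iA)/= lerD2l smallest_sum_le.
Qed.

Section Output.
Context (d : measure_display) (T : measurableType d) (P : probability T R).
Variables (w p : 'I_N -> R) (M : nat) (alpha : R).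
Variables (X : nat -> T -> {set 'I_N}) (U : nat -> {RV P >-> R}).
Hypothesis XU : wrs_randomness M X U.

Let accepted k : set T := [set t | wrs_accept w p alpha (X k t) (U k t)].
Let output := wrs_committee w p alpha X (fun k => U k).

(** There are finitely many possible proposals, and for a fixed one acceptance says that [U k] falls
    in an open half-line. *)
Lemma measurable_wrs_accept k : measurable (accepted k).
Proof.
have -> : accepted k = \bigcup_(B in [set: {set 'I_N}])
    (X k @^-1` [set B] `&` U k @^-1` [set u | wrs_accept w p alpha B u]).
  by apply/seteqP; split => [t acc|t [B _ [/= <-]]]//; exists (X k t).
apply: fin_bigcup_measurable => [|B _]; first exact: finite_finset.
apply: measurableI; first exact: (wrs_measurable XU).
rewrite -[_ @^-1` _]setTI; apply: measurable_funP => //.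
rewrite (_ : [set u | _] =
  `]-oo, ((\sum_(m in B) p m) * (alpha <= \sum_(m in B) w m)%R%:R)[%classic).
  exact: measurable_itv.
by apply/seteqP; split => u; rewrite /= in_itv.
Qed.

(** Splitting by the first accepted round [k] turns the output event into a countable union of
    events about single rounds. *)
Lemma wrs_committee_SomeE (A : {set 'I_N}) :
  [set t | output t = Some A] =
  \bigcup_k (X k @^-1` [set A] `&` accepted k
             `&` \bigcap_(j in `I_k) ~` accepted j).
Proof.
apply/seteqP; split => t /=; rewrite /output /wrs_committee.
  case: pselect => // acc [XA]; exists (ex_minn acc) => //.
  case: ex_minnP XA => k acck mink XA; split => // j /= jk accj.
  by move: (mink j accj); rewrite leqNgt jk.
move=> [k _ [[/= XA acck] rej]]; case: pselect => [acc|[]]; last by exists k.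
congr Some; case: ex_minnP => j accj minj.
suff -> : j = k by [].
apply/eqP; rewrite eqn_leq minj//= leqNgt; apply/negP => jk.
exact: rej j jk accj.
Qed.

Lemma measurable_wrs_committee (A : {set 'I_N}) :
  measurable [set t | output t = Some A].
Proof.
rewrite wrs_committee_SomeE; apply: bigcup_measurable => k _.
apply: measurableI.
  by apply: measurableI; [exact: (wrs_measurable XU)|exact: measurable_wrs_accept].
by apply: bigcap_measurableType => j _; apply: measurableC;
  exact: measurable_wrs_accept.
Qed.

(** A set of the wrong size is proposed with probability 0 in each round, and a countable union of
    null events is null. *)
Lemma wrs_committee_card (A : {set 'I_N}) :
  (0 < P [set t | output t = Some A])%E -> #|A| = M.
Proof.
move=> PA_gt0; apply/eqP/negPn/negP => /negbTE cardA.
suff PA0 : P [set t | output t = Some A] = 0%E by rewrite PA0 ltxx in PA_gt0.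
apply: measure_negligible; first exact: measurable_wrs_committee.
rewrite wrs_committee_SomeE; apply: negligible_bigcup => k.
apply: (@negligibleS _ _ _ _ (X k @^-1` [set A])); first by move=> t [[]].
apply/negligibleP; first exact: (wrs_measurable XU).
by have := wrs_proposal XU k A; rewrite cardA.
Qed.

End Output.
End Committees.

Theorem proposition4p7 (R : realType) (N M : nat) (alpha : R) (w : 'I_N -> R)
    (hM : (2 < M)%N) (hMN : (M < N)%N)
    (halpha0 : 0 < alpha) (halpha1 : alpha < 1)
    (hw_pos : forall i, 0 < w i) (hw_sum : \sum_(i < N) w i = 1)
    (hC : forall i, (0 < committee_count w M alpha i)%N) :
  let p := wrs_p w M alpha in
  exists lambda : R,
    [/\ 0 < lambda,
        (\big[mine/+oo]_(i < N) (w i * (1 + smallest_sum p M i / p i))%:E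
           <= lambda%:E)%E
      & forall (d : measure_display) (T : measurableType d)
          (P : probability T R) (X : nat -> T -> {set 'I_N})
          (U : nat -> {RV P >-> R}),
          wrs_randomness M X U ->
          decentralized P w (wrs_committee w p alpha X (fun k => U k))
            (wrs_weight p) lambda].
Proof.
move=> p; have p_gt0 : forall i, 0 < p i by exact: wrs_p_gt0.
pose f i := w i * (1 + smallest_sum p M i / p i).
have f_gt0 i : 0 < f i.
  rewrite mulr_gt0// ltr_pwDl// divr_ge0 ?(ltW (p_gt0 i))//.
  by apply: smallest_sum_ge0 => j; exact: ltW.
(* The minimizer exists because the index set is nonempty. *)
have i0 : 'I_N by exact: Ordinal (leq_ltn_trans (leq0n M) hMN).
case: (arg_minP f (isT : xpredT i0)) => i _ f_min.
exists (f i); split => //; first exact: (bigmin_inf i).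
move=> d T P X U XU A /(wrs_committee_card XU) cardA.
(* The default value 0 of the maximum must also lie below the bound. *)
apply: bigmax_le => [|m mA]; first by rewrite invr_ge0 ltW.
by apply: (@wrs_voting_power_le R N w p M) => // j; exact: f_min.
Qed.
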